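(* Let $1<p<\infty$ and let $C_{(p)}:\mathrm{ces}(p)\to\mathrm{ces}(p)$ be the Cesàro operator $C_{(p)}(x)=\left(\frac1n\sum_{k=1}^n x_k\right)_{n=1}^\infty$, $x=(x_n)_{n=1}^\infty\in\mathrm{ces}(p)$, which is a positive operator belonging to $\mathcal{L}(\mathrm{ces}(p))$. Then its order spectrum coincides with its spectrum, that is, $\sigma_{\rm o}(C_{(p)})=\sigma(C_{(p)})$.
   Context: $\mathbb{N}=\{1,2,\ldots\}$. For $1<p<\infty$ the discrete Cesàro space is $$\mathrm{ces}(p)=\Big\{x\in\mathbb{C}^{\mathbb{N}}:\|x\|_{\mathrm{ces}(p)}:=\Big(\sum_{n=1}^\infty\Big(\frac1n\sum_{k=1}^n|x_k|\Big)^p\Big)^{1/p}<\infty\Big\},$$ which is a complex Banach lattice for this norm and the coordinatewise order. It is known that the Cesàro operator maps $\mathrm{ces}(p)$ continuously into itself. For a complex Banach lattice $E$, $\mathcal{L}(E)$ is the unital Banach algebra of all continuous linear operators $E\to E$ (unit: the identity $I$). The spectrum of $T\in\mathcal{L}(E)$ is $\sigma(T)=\{\lambda\in\mathbb{C}:\lambda I-T \text{ is not invertible in }\mathcal{L}(E)\}$. An operator $T\in\mathcal{L}(E)$ is regular if it is a finite (complex) linear combination of positive operators; $\mathcal{L}^r(E)$ denotes the set of all regular operators, which is a unital algebra (a Banach algebra for the norm $\|T\|_r=\inf\{\|S\|_{\rm op}:S\in\mathcal{L}(E),\,S\ge0,\,|T(z)|\le S(|z|)\ \forall z\in E\}$).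 The order spectrum of $T\in\mathcal{L}^r(E)$ is $\sigma_{\rm o}(T)=\{\lambda\in\mathbb{C}:\lambda I-T\text{ is not invertible in }\mathcal{L}^r(E)\}$. *)

(* Defs.v *)
From HB Require Import structures.
From mathcomp Require Import all_boot all_order all_algebra.
From mathcomp Require Import all_classical all_reals all_analysis.
From mathcomp Require Import complex ring lra.

Set Implicit Arguments.
Unset Strict Implicit.
Unset Printing Implicit Defensive.

Import Order.TTheory GRing.Theory Num.Theory.
Import numFieldNormedType.Exports.
Import ComplexField.Normc.

Local Open Scope classical_set_scope.
Local Open Scope ring_scope.
Local Open Scope complex_scope.

Definition continuous_operators (K : numFieldType) (E : normedModType K) :
    set (E -> E) :=
  [set T | linear T /\ continuous T].
Arguments continuous_operators {K} E.

Definition spectrum_in (K : numFieldType) (E : normedModType K)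
    (A : set (E -> E)) (T : E -> E) : set K :=
  [set l | ~ exists S : E -> E, [/\ A S,
     forall x, S (l *: x - T x) = x & forall x, l *: S x - T (S x) = x]].

Definition spectrum (K : numFieldType) (E : normedModType K) (T : E -> E) :
    set K :=
  spectrum_in (continuous_operators E) T.

(* Sequences are indexed from 0: u k stands for the term of index k + 1. *)
Definition cesaro_mean (K : numFieldType) (u : nat -> K) (n : nat) : K :=
  n.+1%:R^-1 * \sum_(k < n.+1) u k.

Section LpNorm.
Context {R : realType} (p : R).
Implicit Types (a b : nat -> R).

Definition lp_norm a : \bar R :=
  ((\sum_(0 <= n <oo) (`|a n| `^ p)%:E) `^ p^-1)%E.

Hypothesis p1 : 1 < p.

Let p_gt0 : 0 < p. Proof. exact: lt_trans p1. Qed.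
Let p_neq0 : p != 0. Proof. by rewrite gt_eqF. Qed.
Let pV_neq0 : p^-1 != 0. Proof. by rewrite invr_eq0. Qed.

Let term_ge0 a n : (0 <= (`|a n| `^ p)%:E)%E.
Proof. by rewrite lee_fin powR_ge0. Qed.

Let series_ge0 a : (0 <= \sum_(0 <= n <oo) (`|a n| `^ p)%:E)%E.
Proof. by apply: nneseries_ge0 => n _ _; exact: term_ge0. Qed.

Lemma lp_norm_ge0 a : (0 <= lp_norm a)%E.
Proof. exact: poweR_ge0. Qed.

Lemma lp_normE a : lp_norm a = 'N[@counting nat R]_p%:E[EFin \o a]%E.
Proof. by rewrite Lnorm_counting. Qed.

Lemma le_lp_norm a b : (forall n, `|a n| <= `|b n|) ->
  (lp_norm a <= lp_norm b)%E.
Proof.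
move=> ab; apply: gt0_ler_poweR.
- by rewrite invr_ge0 ltW.
- by rewrite in_itv /= series_ge0 leey.
- by rewrite in_itv /= series_ge0 leey.
apply: lee_nneseries => [n _ _|n _]; first exact: term_ge0.
by rewrite lee_fin; apply: ge0_ler_powR; rewrite ?nnegrE // ltW.
Qed.

Lemma lp_normD a b :
  (lp_norm (fun n => a n + b n)%R <= lp_norm a + lp_norm b)%E.
Proof. by rewrite !lp_normE; apply: minkowski_EFin => //; exact: ltW. Qed.

Lemma lp_normZ (c : R) a :
  lp_norm (fun n => c * a n) = (`|c|%:E * lp_norm a)%E.
Proof.
rewrite /lp_norm.
under eq_eseriesr => n _ do rewrite normrM powRM // EFinM.
rewrite nneseriesZl; last by move=> n _; exact: term_ge0.
rewrite poweRM ?lee_fin ?powR_ge0 //.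
by rewrite poweR_EFin -powRrM mulfV // powRr1.
Qed.

Lemma lp_norm0_eq0 a : lp_norm a = 0%E -> forall n, a n = 0.
Proof.
move=> /(poweR_eq0_eq0 (series_ge0 a)) a0 n.
have : ((`|a n| `^ p)%:E <= 0)%E.
  rewrite -a0 (nneseriesD1 (n := n)) //.
  by rewrite leeDl //; apply: nneseries_ge0 => k _ _; exact: term_ge0.
rewrite lee_fin => an0.
have /eqP : `|a n| `^ p = 0 by apply/eqP; rewrite eq_le an0 powR_ge0.
by rewrite powR_eq0 normr_eq0 => /andP[/eqP].
Qed.

Let young (u v : R) : 0 <= u -> 0 <= v ->
  p * (u * v `^ (p - 1)) <= u `^ p + (p - 1) * v `^ p.
Proof.
move=> u0 v0; have q0 : 0 < p - 1 by rewrite subr_gt0.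
have := @conjugate_powR _ u (v `^ (p - 1)) p (p / (p - 1)) u0 (powR_ge0 _ _)
  p_gt0 (divr_gt0 p_gt0 q0).
rewrite invf_div -powRrM (_ : (p - 1) * (p / (p - 1)) = p); last first.
  by field; rewrite gt_eqF.
have -> : p^-1 + (p - 1) / p = 1 by field.
move=> /(_ erefl); rewrite -(ler_pM2l p_gt0) => /le_trans; apply.
by rewrite le_eqVlt; apply/orP; left; apply/eqP; field; rewrite p_neq0.
Qed.

Let B b n : R := n%:R^-1 * \sum_(k < n) b k.

Let B_ge0 b n : (forall n, 0 <= b n) -> 0 <= B b n.
Proof. by move=> b0; rewrite mulr_ge0 ?invr_ge0 // sumr_ge0. Qed.

Let hardy_aux b N : (forall n, 0 <= b n) ->
  (p - 1) * (\sum_(n < N) B b n.+1 `^ p) + N%:R * B b N `^ p <=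
  \sum_(n < N) p * (b n * B b n.+1 `^ (p - 1)).
Proof.
move=> b0; elim: N => [|N IH]; first by rewrite !big_ord0 mul0r mulr0 addr0.
rewrite !big_ord_recr /=.
have NB : N%:R * B b N = \sum_(k < N) b k.
  case: (N) => [|m]; first by rewrite mul0r big_ord0.
  by rewrite /B mulrA mulfV ?mul1r // pnatr_eq0.
have NB1 : b N = N.+1%:R * B b N.+1 - N%:R * B b N.
  rewrite NB /B mulrA mulfV ?pnatr_eq0 // mul1r big_ord_recr /=; ring.
have BB := mulr_powRB1 (B_ge0 N.+1 b0) p_gt0.
have Y := young (B_ge0 N b0) (B_ge0 N.+1 b0).
have {}Y : N%:R * (p * (B b N * B b N.+1 `^ (p - 1))) <=
    N%:R * (B b N `^ p + (p - 1) * B b N.+1 `^ p).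
  by rewrite ler_wpM2l.
rewrite [in X in _ <= _ + X]NB1.
have NS : N.+1%:R = N%:R + 1 :> R by rewrite natr1.
rewrite NS; move: IH Y BB.
set X := B b N; set Z := B b N.+1; set Zp := Z `^ (p - 1).
set S1 := \sum_(n < N) _; set S2 := \sum_(n < N) _ => IH Y BB.
have -> : p * (((N%:R + 1) * Z - N%:R * X) * Zp) =
  p * (N%:R + 1) * Z `^ p - N%:R * (p * (X * Zp)) by rewrite -BB; ring.
lra.
Qed.

Lemma hardy_sum b N : (forall n, 0 <= b n) ->
  \sum_(n < N) cesaro_mean b n `^ p <=
  2 `^ p / (p - 1) * \sum_(n < N) b n `^ p.
Proof.
move=> b0; have q0 : 0 < p - 1 by rewrite subr_gt0.
have H := hardy_aux N b0.
have Y : \sum_(n < N) p * (b n * B b n.+1 `^ (p - 1)) <=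
    \sum_(n < N) (2 `^ p / 2 * b n `^ p + (p - 1) / 2 * B b n.+1 `^ p).
  apply: ler_sum => n _.
  have := young (mulr_ge0 (ler0n R 2) (b0 n)) (B_ge0 n.+1 b0).
  rewrite [(2 * b n) `^ p]powRM //.
  set z := B b n.+1 `^ p; set w := B b n.+1 `^ (p - 1).
  set v := b n `^ p; set t := 2 `^ p; set u := b n.
  by clearbody z w v t u => Z; lra.
move: Y; rewrite big_split /= -!mulr_sumr => Y.
rewrite mulrAC ler_pdivlMr //.
have BN : 0 <= N%:R * B b N `^ p by rewrite mulr_ge0 // powR_ge0.
have -> : \sum_(n < N) cesaro_mean b n `^ p = \sum_(n < N) B b n.+1 `^ p by [].
move: H Y BN; rewrite -mulr_sumr.
set s := \sum_(n < N) B b _ `^ p; set t := \sum_(n < N) b n `^ p.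
set u := 2 `^ p; set v := \sum_(n < N) b n * _; set w := N%:R * _.
clearbody s t u v w => H Y BN.
lra.
Qed.

(* Discrete Hardy inequality, with a non-optimal constant. *)
Lemma hardy b : (forall n, 0 <= b n) ->
  (lp_norm (cesaro_mean b) <= ((2 `^ p / (p - 1)) `^ p^-1)%:E * lp_norm b)%E.
Proof.
move=> b0; have q0 : 0 < p - 1 by rewrite subr_gt0.
have K0 : 0 <= 2 `^ p / (p - 1) by rewrite divr_ge0 ?powR_ge0 // ltW.
rewrite -poweR_EFin -poweRM ?lee_fin //; apply: gt0_ler_poweR.
- by rewrite invr_ge0 ltW.
- by rewrite in_itv /= series_ge0 leey.
- by rewrite in_itv /= mule_ge0 ?lee_fin // leey.
rewrite -nneseriesZl; last by move=> n _; exact: term_ge0.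
apply: lime_le; first by apply: is_cvg_nneseries => n _ _; exact: term_ge0.
apply: nearW => N.
apply: le_trans (nneseries_lim_ge N _); last first.
  by move=> n _ _; rewrite mule_ge0 ?lee_fin // powR_ge0.
under [leRHS]eq_bigr do rewrite -EFinM.
rewrite !sumEFin lee_fin !big_mkord -mulr_sumr.
have -> : \sum_(n < N) `|cesaro_mean b n| `^ p =
    \sum_(n < N) cesaro_mean b n `^ p.
  by apply: eq_bigr => n _; rewrite ger0_norm //; exact: (B_ge0 n.+1).
under [in leRHS]eq_bigr do rewrite ger0_norm //.
exact: hardy_sum.
Qed.

End LpNorm.

Lemma ler_cesaro_mean (R : numFieldType) (a b : nat -> R) n :
  (forall k, a k <= b k) -> cesaro_mean a n <= cesaro_mean b n.
Proof. by move=> ab; rewrite ler_pM2l ?invr_gt0 ?ltr0n //; exact: ler_sum. Qed.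

Section Ces.
Context {R : realType} (p : R).
Implicit Types x y : nat -> R[i].

Definition ces_norm x : \bar R :=
  ((\sum_(0 <= n <oo) (cesaro_mean (fun k => normc (x k)) n `^ p)%:E) `^ p^-1)%E.

Lemma normc_ge0 (z : R[i]) : 0 <= normc z.
Proof. by case: z => a b; exact: sqrtr_ge0. Qed.

Lemma cesaro_mean_normc_ge0 x n : 0 <= cesaro_mean (fun k => normc (x k)) n.
Proof.
by rewrite mulr_ge0 ?invr_ge0 // sumr_ge0 // => k _; exact: normc_ge0.
Qed.

Lemma ces_normE x : ces_norm x = lp_norm p (cesaro_mean (fun k => normc (x k))).
Proof.
rewrite /ces_norm /lp_norm; congr (_ `^ _)%E.
by apply: eq_eseriesr => n _; rewrite ger0_norm ?cesaro_mean_normc_ge0.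
Qed.

Lemma ces_norm_ge0 x : (0 <= ces_norm x)%E.
Proof. exact: poweR_ge0. Qed.

Definition ces_pred : {pred nat -> R[i]} := [pred x | `[< ces_norm x < +oo >]%E].

(* The bound on p is a parameter of the type, as for LfunType, because the
   normed space structure depends on it. *)
Record ces (p1 : 1 < p) :=
  Ces { ces_seq :> nat -> R[i] ; ces_seqP : ces_seq \in ces_pred }.

Hypothesis p1 : 1 < p.

Lemma ces_normD x y :
  (ces_norm (fun n => x n + y n)%R <= ces_norm x + ces_norm y)%E.
Proof.
rewrite !ces_normE; apply: le_trans (lp_normD p1 _ _).
apply: le_lp_norm => // n; rewrite !ger0_norm ?addr_ge0 ?cesaro_mean_normc_ge0 //.
rewrite /cesaro_mean -mulrDr -big_split /=.
by rewrite ler_pM2l ?invr_gt0 ?ltr0n // ler_sum // => k _; exact: le_normcD.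
Qed.

Lemma ces_normZ (l : R[i]) x :
  ces_norm (fun n => l * x n) = ((normc l)%:E * ces_norm x)%E.
Proof.
rewrite !ces_normE -(ger0_norm (normc_ge0 l)) -lp_normZ //.
congr lp_norm; apply/funext => n; rewrite /cesaro_mean mulrCA; congr (_ * _).
by rewrite mulr_sumr; apply: eq_bigr => k _; exact: normcM.
Qed.

Lemma ces_norm0_eq0 x : ces_norm x = 0%E -> forall n, x n = 0.
Proof.
rewrite ces_normE => /lp_norm0_eq0 x0 n.
have /eqP := x0 n; rewrite mulf_eq0 invr_eq0 pnatr_eq0 /= psumr_eq0; last first.
  by move=> k _; exact: normc_ge0.
move=> /allP /(_ (@ord_max n) (mem_index_enum _)) /eqP; exact: eq0_normc.
Qed.

Lemma ces_submod_closed : subsemimod_closed ces_pred.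
Proof.
split; first split.
- apply/asboolP; have := ces_normZ 0 (fun=> 0).
  rewrite normc0 mul0e; under eq_fun do rewrite mul0r.
  by move=> ->; rewrite ltry.
- move=> x y /asboolP xoo /asboolP yoo; apply/asboolP.
  by apply: le_lt_trans (ces_normD x y) _; rewrite lte_add_pinfty.
- move=> l x /asboolP xoo; apply/asboolP.
  rewrite [ltLHS](ces_normZ l x) lte_mul_pinfty ?lee_fin //; exact: normc_ge0.
Qed.

HB.instance Definition _ := [isSub for @ces_seq p1].
HB.instance Definition _ := [Choice of ces p1 by <:].
HB.instance Definition _ :=
  Order.SubChoice_isSubPOrder.Build _ _ _ ring_display (ces p1).
HB.instance Definition _ :=
  GRing.SubChoice_isSubLmodule.Build R[i] (nat -> R[i]) ces_pred (ces p1)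
    ces_submod_closed.

Definition ces_Cnorm (x : ces p1) : R[i] := (fine (ces_norm x))%:C.

Lemma ces_norm_fineK (x : ces p1) : (fine (ces_norm x))%:E = ces_norm x.
Proof.
by rewrite fineK // ge0_fin_numE ?ces_norm_ge0 //; exact/asboolP/(ces_seqP x).
Qed.

Lemma ces_CnormD (x y : ces p1) : ces_Cnorm (x + y) <= ces_Cnorm x + ces_Cnorm y.
Proof.
rewrite -rmorphD lecR -lee_fin EFinD !ces_norm_fineK; exact: ces_normD.
Qed.

Lemma ces_CnormZ (l : R[i]) (x : ces p1) : ces_Cnorm (l *: x) = `|l| * ces_Cnorm x.
Proof.
have -> : `|l| = (normc l)%:C by [].
rewrite -rmorphM; congr _%:C; apply: EFin_inj.
rewrite EFinM !ces_norm_fineK; exact: ces_normZ.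
Qed.

Lemma ces_Cnorm0_eq0 (x : ces p1) : ces_Cnorm x = 0 -> x = 0.
Proof.
move=> /complexI x0; apply/val_inj/funext.
by apply: ces_norm0_eq0; rewrite -ces_norm_fineK x0.
Qed.

HB.instance Definition _ :=
  Lmodule_isNormed.Build R[i] (ces p1) ces_CnormD ces_CnormZ ces_Cnorm0_eq0.

Lemma ces_CnormE (x : ces p1) : `|x| = (fine (ces_norm x))%:C.
Proof. by []. Qed.

Lemma cesleP (x y : ces p1) : reflect (forall n, x n <= y n) (x <= y).
Proof. exact: lefP. Qed.

Lemma cesaro_mean_in_ces x : x \in ces_pred -> cesaro_mean x \in ces_pred.
Proof.
move=> /asboolP xoo; apply/asboolP; apply: (@le_lt_trans _ _
  (((2 `^ p / (p - 1)) `^ p^-1)%:E * ces_norm x)%E); last first.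
  by rewrite lte_mul_pinfty // lee_fin powR_ge0.
rewrite !ces_normE.
apply: le_trans (hardy p1 (cesaro_mean_normc_ge0 x)).
apply: le_lp_norm => // n.
have ge0 k : 0 <= cesaro_mean (cesaro_mean (fun k => normc (x k))) k.
  rewrite mulr_ge0 ?invr_ge0 // sumr_ge0 // => i _.
  exact: cesaro_mean_normc_ge0.
rewrite !ger0_norm ?cesaro_mean_normc_ge0 //.
apply: ler_cesaro_mean => k; rewrite /= /cesaro_mean normcM.
have -> : normc (k.+1%:R^-1 : R[i]) = k.+1%:R^-1.
  by rewrite normcV (normcMn 1) normc1.
rewrite ler_pM2l ?invr_gt0 ?ltr0n //.
elim/big_ind2: _ => [|u u' v v' le1 le2|//]; first by rewrite normc0.
exact: le_trans (le_normcD _ _) (lerD le1 le2).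
Qed.

Definition cesaro_operator (x : ces p1) : ces p1 :=
  Ces p1 (cesaro_mean_in_ces (ces_seqP x)).

End Ces.
Arguments cesaro_operator {R p} p1 x.

Section RegularOperators.
Context {R : realType} {p : R} {p1 : 1 < p}.

Definition positive_operator (T : ces p1 -> ces p1) : Prop :=
  forall x : ces p1, 0 <= x -> 0 <= T x.

Definition regular_operators : set (ces p1 -> ces p1) :=
  [set T | continuous_operators (ces p1) T /\
    exists (n : nat) (c : 'I_n -> R[i]) (S : 'I_n -> ces p1 -> ces p1),
      (forall i, continuous_operators (ces p1) (S i) /\
                 positive_operator (S i)) /\
      (forall x : ces p1, T x = \sum_(i < n) c i *: S i x)].

Definition order_spectrum (T : ces p1 -> ces p1) : set R[i] :=
  spectrum_in regular_operators T.

End RegularOperators.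

(* Main.v *)
(* Put z = 1/l. If S inverts l - C and y = S x, then y = z (x + Y), where the
   means Y = C y satisfy (n - z) Y_n = (n - 1) Y_(n-1) + z x_n; hence
   S = z I + z^2 V_z for an explicit lower triangular matrix V_z.

   If Re z < 1 - 1/p, then |n - z| >= n - Re z > 0, so the entries of V_z are
   dominated by those of the nonnegative matrix V_(Re z), and an energy estimate
   of Hardy type bounds V_(Re z) on ces(p). The positive and negative parts of
   Re V_z and Im V_z are then bounded positive operators, so S is regular.

   The mere existence of S rules out all other l: l = 0, because C maps ces(p)
   into l^p whereas far unit vectors are small in ces(p); z = n, because the
   n-th unit vector is not in the range of l - C; and Re z >= 1 - 1/p, because
   the means of S e_1 decay so slowly that they are not in l^p. *)
From HB Require Import structures.
Require Import Defs.
From mathcomp Require Import all_boot all_order all_algebra.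
From mathcomp Require Import all_classical all_reals all_analysis.
From mathcomp Require Import complex ring lra.
Import Order.TTheory GRing.Theory Num.Theory.
Import numFieldNormedType.Exports.
Import ComplexField.Normc.
Local Open Scope classical_set_scope.
Local Open Scope ring_scope.
Local Open Scope complex_scope.

(** * Cesàro means and the recursion they satisfy *)

Lemma cesaro_meanE {K : numFieldType} (u : nat -> K) n :
  n.+1%:R * cesaro_mean u n = \sum_(k < n.+1) u k.
Proof. by rewrite mulrA mulfV ?mul1r // pnatr_eq0. Qed.

Lemma cesaro_meanS {K : numFieldType} (u : nat -> K) n :
  n.+2%:R * cesaro_mean u n.+1 = n.+1%:R * cesaro_mean u n + u n.+1.
Proof. by rewrite !cesaro_meanE big_ord_recr. Qed.

Lemma cesaro_meanD {K : numFieldType} (u v : nat -> K) n :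
  cesaro_mean (fun k => u k + v k) n = cesaro_mean u n + cesaro_mean v n.
Proof. by rewrite /cesaro_mean big_split mulrDr. Qed.

Lemma cesaro_meanZ {K : numFieldType} (c : K) (u : nat -> K) n :
  cesaro_mean (fun k => c * u k) n = c * cesaro_mean u n.
Proof. by rewrite /cesaro_mean -mulr_sumr mulrCA. Qed.

Lemma cesaro_mean_ge0 {K : numFieldType} (u : nat -> K) n :
  (forall k, 0 <= u k) -> 0 <= cesaro_mean u n.
Proof. by move=> u0; rewrite mulr_ge0 ?invr_ge0 ?sumr_ge0. Qed.

Definition triangular {K : pzRingType} (c : nat -> nat -> K) (x : nat -> K)
  (n : nat) : K := \sum_(m < n.+1) c n m * x m.

(** The matrix V_z, read for m <= n: in the recursion of [triangular_resolventS] a source at m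
    enters with the factor 1 / (m + 1 - z), and each later step multiplies it by (k + 1) / (k + 2 -
    z). For z = 0 every entry of row n is 1 / (n + 1). *)
Definition resolvent_kernel {K : numFieldType} (z : K) (n m : nat) : K :=
  (\prod_(m <= k < n) (k.+1%:R / (k.+2%:R - z))) / (m.+1%:R - z).

Lemma triangular_resolvent0 {K : numFieldType} (z : K) x : z != 1 ->
  (1 - z) * triangular (resolvent_kernel z) x 0 = x 0.
Proof.
move=> z1; rewrite /triangular big_ord1 /resolvent_kernel big_geq //.
by rewrite mul1r mulVKf // subr_eq0 eq_sym.
Qed.

Lemma triangular_resolventS {K : numFieldType} (z : K) x n : z != n.+2%:R ->
  (n.+2%:R - z) * triangular (resolvent_kernel z) x n.+1 =
  n.+1%:R * triangular (resolvent_kernel z) x n + x n.+1.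
Proof.
move=> zn; have d0 : n.+2%:R - z != 0 by rewrite subr_eq0 eq_sym.
rewrite /triangular big_ord_recr /= mulrDr; congr (_ + _); last first.
  by rewrite /resolvent_kernel big_geq // mul1r mulVKf.
rewrite !mulr_sumr; apply: eq_bigr => -[m /= mn] _.
rewrite /resolvent_kernel big_nat_recr //=.
rewrite -!mulrA mulrCA [RHS]mulrCA; congr (_ * _).
by rewrite mulrCA mulVKf.
Qed.

(** Both conditions amount to the same first-order recursion, whose leading coefficients n + 1 - z
    do not vanish, so they determine the same [y]. *)
Lemma triangular_resolventE {K : numFieldType} (z : K) x y :
  (forall n, z != n.+1%:R) ->
  (forall n, y n = cesaro_mean (fun k => x k + z * y k) n) <->
  (forall n, y n = triangular (resolvent_kernel z) x n).
Proof.
move=> zn; have d0 n : n.+1%:R - z != 0 by rewrite subr_eq0 eq_sym.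
split=> yE; elim=> [|n IH].
- apply: (mulfI (d0 0%N)); rewrite triangular_resolvent0 ?(zn 0%N) //.
  have := yE 0%N; rewrite /cesaro_mean big_ord1 invr1 mul1r => e.
  by rewrite mulrBl mul1r {1}e addrK.
- apply: (mulfI (d0 n.+1)); rewrite triangular_resolventS // -IH.
  have := cesaro_meanS (fun k => x k + z * y k) n.
  by rewrite -!yE => e; rewrite mulrBl e; ring.
- have := triangular_resolvent0 z x (zn 0%N).
  by rewrite -yE /cesaro_mean big_ord1 invr1 mul1r => <-; ring.
- apply: (@mulfI _ n.+2%:R); rewrite ?pnatr_eq0 // cesaro_meanS -IH yE.
  have := triangular_resolventS z x n (zn n.+1).
  by rewrite -!yE mulrBl => /(canRL (subrK _)) ->; ring.
Qed.

(** * Energy estimate of Hardy type *)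

Section Energy.
Context {R : realType} {p : R}.
Hypothesis p1 : 1 < p.

Let p_gt0 : 0 < p. Proof. exact: lt_trans p1. Qed.
Let q_gt0 : 0 < 1 - p^-1. Proof. by rewrite subr_gt0 invf_lt1. Qed.

Lemma young_powR (u v : R) : 0 <= u -> 0 <= v ->
  u * v `^ (p - 1) <= p^-1 * u `^ p + (1 - p^-1) * v `^ p.
Proof.
move=> u0 v0; have pq : 1 - p^-1 = (p - 1) / p.
  by rewrite mulrBl mul1r divff // gt_eqF.
have := @conjugate_powR _ u (v `^ (p - 1)) p (1 - p^-1)^-1 u0 (powR_ge0 _ _)
  p_gt0.
rewrite invr_gt0 q_gt0 invrK addrC subrK => /(_ isT erefl).
rewrite -powRrM pq invf_div (mulrC (p - 1) (p / (p - 1))) 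
  divfK ?subr_eq0 ?gt_eqF //.
by rewrite [u `^ p * _]mulrC [v `^ p * _]mulrC.
Qed.

(* Multiplying the recursion [(n + 2 - a) W (n + 1) = (n + 1) W n + f (n + 1)]
   by [W (n + 1) `^ (p - 1)] and applying Young's inequality to the cross term
   makes the sum telescope; [a = 0] is the classical proof of Hardy's
   inequality. *)
Lemma resolvent_energy (a : R) (f W : nat -> R) (n : nat) :
  (forall k, 0 <= W k) ->
  (forall k, W k = cesaro_mean (fun i => f i + a * W i) k) ->
  (1 - p^-1 - a) * (\sum_(k < n.+1) W k `^ p) + p^-1 * n.+1%:R * W n `^ p <=
  \sum_(k < n.+1) f k * W k `^ (p - 1).
Proof.
move=> W0 WE; elim: n => [|n IH].
  rewrite !big_ord1 mulr1.
  have := WE 0%N; rewrite /cesaro_mean big_ord1 invr1 mul1r.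
  move=> /esym /(canRL (addrK _)) ->.
  by rewrite -(mulr_powRB1 (W0 0%N) p_gt0); lra.
rewrite big_ord_recr [leRHS]big_ord_recr /=.
have WS : f n.+1 = (n.+2%:R - a) * W n.+1 - n.+1%:R * W n.
  have := cesaro_meanS (fun i => f i + a * W i) n; rewrite -!WE => e.
  by rewrite mulrBl e; ring.
rewrite WS -[W n.+1 `^ p](mulr_powRB1 (W0 _) p_gt0).
have := young_powR (W n) (W n.+1) (W0 _) (W0 _).
rewrite -(ler_pM2l (ltr0Sn R n)) -[n.+2%:R]natr1.
move: IH; rewrite mulrA.
rewrite -[W n.+1 `^ p](mulr_powRB1 (W0 _) p_gt0).
set A := W n `^ p; set B := W n.+1 `^ _; set N := n.+1%:R.
set S1 := \sum_(k < n.+1) _; set S2 := \sum_(k < n.+1) _.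
set P := p^-1 => IH Y.
nra.
Qed.

(** With d = 1 - 1/p - a, drop the boundary term of [resolvent_energy] and apply Young's inequality
    to f / d and W. This leaves 1 - 1/p times the sum of the p-th powers of W on the right, and the
    finite sum on the left absorbs it. *)
Lemma resolvent_bound (a : R) (f W : nat -> R) (n : nat) :
  a < 1 - p^-1 -> (forall k, 0 <= f k) -> (forall k, 0 <= W k) ->
  (forall k, W k = cesaro_mean (fun i => f i + a * W i) k) ->
  \sum_(k < n) W k `^ p <= \sum_(k < n) ((1 - p^-1 - a)^-1 * f k) `^ p.
Proof.
move=> aq f0 W0 WE; case: n => [|n]; first by rewrite !big_ord0.
have d0 : 0 < 1 - p^-1 - a by rewrite subr_gt0.
have := resolvent_energy a f W n W0 WE; set d := 1 - p^-1 - a => E.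
have E1 : d * \sum_(k < n.+1) W k `^ p <= \sum_(k < n.+1) f k * W k `^ (p - 1).
  apply: le_trans E; rewrite lerDl mulr_ge0 ?powR_ge0 // mulr_ge0 ?ler0n //.
  by rewrite invr_ge0 ltW.
have E2 : d^-1 * \sum_(k < n.+1) f k * W k `^ (p - 1) <=
    p^-1 * (\sum_(k < n.+1) (d^-1 * f k) `^ p) +
    (1 - p^-1) * \sum_(k < n.+1) W k `^ p.
  rewrite !mulr_sumr -big_split /=; apply: ler_sum => k _.
  by rewrite mulrA; apply: young_powR => //; rewrite mulr_ge0 // invr_ge0 ltW.
rewrite -(ler_pM2l d0) in E2; rewrite mulVKf ?gt_eqF // in E2.
have := le_trans E1 E2; rewrite ler_pM2l // => E3.
rewrite -(ler_pM2l (x := p^-1)) ?invr_gt0 //; lra.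
Qed.

End Energy.

(** * Triangular matrices dominated by a real resolvent kernel *)

Section Triangular.
Context {R : realType} {p : R} {p1 : 1 < p}.
Implicit Types (c : nat -> nat -> R[i]) (x y : nat -> R[i]).

Lemma normc_ge_Re_Im (w : R[i]) :
  `|complex.Re w| <= normc w /\ `|complex.Im w| <= normc w.
Proof.
case: w => a b /=; rewrite -!sqrtr_sqr.
by split; apply: ler_wsqrtr; rewrite ?lerDl ?lerDr sqr_ge0.
Qed.

Lemma normc_sum n (F : 'I_n -> R[i]) :
  normc (\sum_(i < n) F i) <= \sum_(i < n) normc (F i).
Proof.
elim/big_ind2: _ => [|u u' v v' le1 le2|//]; first by rewrite normc0.
exact: le_trans (le_normcD _ _) (lerD le1 le2).
Qed.

Lemma resolvent_kernel_ge0 (a : R) n m : a < 1 -> 0 <= resolvent_kernel a n m.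
Proof.
move=> a1; have d0 k : 0 <= k.+1%:R - a.
  by rewrite subr_ge0 (le_trans (ltW a1)) // ler1n.
by rewrite divr_ge0 // prodr_ge0 // => k _; rewrite divr_ge0.
Qed.

Lemma normc_resolvent_kernel (z : R[i]) (a : R) n m :
  complex.Re z <= a -> a < 1 ->
  normc (resolvent_kernel z n m) <= resolvent_kernel a n m.
Proof.
move=> za a1.
have d0 k : 0 < k.+1%:R - a by rewrite subr_gt0 (lt_le_trans a1) // ler1n.
have d1 k : k.+1%:R - a <= normc (k.+1%:R - z).
  apply: le_trans (normc_ge_Re_Im _).1; apply: le_trans (ler_norm _).
  have -> : complex.Re (k.+1%:R - z) = k.+1%:R - complex.Re z.
    by rewrite !raddfB /= raddfMn.
  by rewrite lerB.
have d2 k : normc (k.+1%:R - z)^-1 <= (k.+1%:R - a)^-1.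
  rewrite normcV lef_pV2 ?posrE //; exact: lt_le_trans (d1 k).
rewrite normcM ler_pM ?normc_ge0 //.
rewrite (big_morph _ (@normcM R) (@normc1 R)) ler_prod // => k _.
rewrite normc_ge0 normcM (normcMn 1) normc1.
by rewrite ler_wpM2l.
Qed.

Lemma normc_triangular c (b : nat -> nat -> R) x n :
  (forall n m, normc (c n m) <= b n m) ->
  normc (triangular c x n) <= triangular b (fun k => normc (x k)) n.
Proof.
move=> cb; apply: le_trans (normc_sum _ _) _; apply: ler_sum => m _.
by rewrite normcM ler_wpM2r // normc_ge0.
Qed.

(** Reduces norm bounds to inequalities between partial sums, the form in which [resolvent_bound] is
    stated. *)
Lemma ces_norm_le (K : R) x y : 0 <= K ->
  (forall n, \sum_(k < n) cesaro_mean (fun i => normc (x i)) k `^ p <=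
    \sum_(k < n) (K * cesaro_mean (fun i => normc (y i)) k) `^ p) ->
  (ces_norm p x <= K%:E * ces_norm p y)%E.
Proof.
move=> K0 xy; have p0 : 0 < p by apply: lt_trans p1.
have -> : (K%:E * ces_norm p y = ((\sum_(0 <= n <oo)
    ((K * cesaro_mean (fun k => normc (y k)) n) `^ p)%:E) `^ p^-1))%E.
  under eq_eseriesr => n _ do
    rewrite powRM ?cesaro_mean_normc_ge0 // EFinM.
  rewrite nneseriesZl; last by move=> n _; rewrite lee_fin powR_ge0.
  rewrite poweRM ?lee_fin ?powR_ge0 //; last first.
    by apply: nneseries_ge0 => n _ _; rewrite lee_fin powR_ge0.
  by rewrite poweR_EFin -powRrM mulfV ?gt_eqF // powRr1.
have ge0 (u : nat -> R) : (0 <= \sum_(0 <= n <oo) (u n `^ p)%:E)%E.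
  by apply: nneseries_ge0 => n _ _; rewrite lee_fin powR_ge0.
apply: gt0_ler_poweR; rewrite ?in_itv /= ?ge0 ?leey ?invr_ge0 ?(ltW p0) //.
apply: lime_le.
  by apply: is_cvg_nneseries => n _ _; rewrite lee_fin powR_ge0.
apply: nearW => N; apply: le_trans (nneseries_lim_ge N _); last first.
  by move=> n _ _; rewrite lee_fin powR_ge0.
by rewrite !sumEFin lee_fin !big_mkord.
Qed.

(** The ces(p) norm is the l^p norm of the averages. Averaging the equation W = C (f + a W) yields
    the same equation for C W with source C f, so the l^p estimate [resolvent_bound] applies one
    level up. *)
Lemma ces_norm_triangular c (a : R) x : a < 1 - p^-1 ->
  (forall n m, normc (c n m) <= resolvent_kernel a n m) ->
  (ces_norm p (triangular c x) <= (1 - p^-1 - a)^-1%:E * ces_norm p x)%E.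
Proof.
move=> aq cb; have p0 : 0 < p by apply: lt_trans p1.
have a1 : a < 1 by rewrite (lt_le_trans aq) // gerBl invr_ge0 ltW.
apply: ces_norm_le => [|n]; first by rewrite invr_ge0 subr_ge0 ltW.
set f := fun i => normc (x i); set W := triangular (resolvent_kernel a) f.
have W0 k : 0 <= W k.
  by apply: sumr_ge0 => i _; rewrite mulr_ge0 ?normc_ge0 ?resolvent_kernel_ge0.
have WE : forall k, W k = cesaro_mean (fun i => f i + a * W i) k.
  apply/triangular_resolventE => // k.
  by rewrite lt_eqF // (lt_le_trans a1) // ler1n.
apply: (@le_trans _ _ (\sum_(k < n) cesaro_mean W k `^ p)).
  apply: ler_sum => k _; apply: ge0_ler_powR; rewrite ?nnegrE ?(ltW p0) //.
  - exact: cesaro_mean_normc_ge0.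
  - exact: cesaro_mean_ge0.
  - by apply: ler_cesaro_mean => i; exact: normc_triangular.
apply: (resolvent_bound p1) => // [k|k|k].
- exact: cesaro_mean_normc_ge0.
- exact: cesaro_mean_ge0.
- rewrite [in LHS](funext WE); congr (cesaro_mean _ k); apply/funext => i.
  by rewrite cesaro_meanD cesaro_meanZ.
Qed.

Lemma ces_ext (x y : ces p1) : (forall n, x n = y n) -> x = y.
Proof. by move=> xy; apply/val_inj/funext. Qed.

Lemma ces_bounded_continuous (T : ces p1 -> ces p1) (K : R) : linear T ->
  (forall x : ces p1, (ces_norm p (T x) <= K%:E * ces_norm p x)%E) ->
  continuous_operators (ces p1) T.
Proof.
move=> linT TK; split=> //.
pose f : {linear ces p1 -> ces p1} :=
  HB.pack T (GRing.isLinear.Build _ _ _ _ T linT).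
apply: (@bounded_linear_continuous _ _ _ f).
apply/ex_bound; exists (`|K|)%:C; near=> x.
have : `|x| <= 1 by near: x; exact: nbhs0_le.
rewrite !ces_CnormE -[1]/(1%:C) lecR => x1; rewrite /= lecR.
rewrite -lee_fin ces_norm_fineK; apply: le_trans (TK x) _.
rewrite -ces_norm_fineK -EFinM lee_fin.
apply: le_trans (ler_norm _) _; rewrite normrM ler_piMr //.
by rewrite ger0_norm // fine_ge0 // ces_norm_ge0.
Unshelve. all: by end_near. Qed.

Lemma triangular_in_ces c (K : R) (x : ces p1) :
  (ces_norm p (triangular c x) <= K%:E * ces_norm p x)%E ->
  triangular c x \in ces_pred p.
Proof.
move=> xK; apply/asboolP; apply: le_lt_trans xK _.
by rewrite -ces_norm_fineK -EFinM ltry.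
Qed.

Lemma triangular_linear c (T : ces p1 -> ces p1) :
  (forall (x : ces p1) n, T x n = triangular c x n) -> linear T.
Proof.
move=> TE u x y; apply: ces_ext => n; rewrite TE.
have -> : (u *: T x + T y) n = u * T x n + T y n by [].
rewrite !TE /triangular mulr_sumr -big_split; apply: eq_bigr => i _.
by transitivity (c n i * (u * x i + y i)); [| rewrite /= mulrDr mulrCA].
Qed.

End Triangular.

(** * Regularity by splitting into positive operators *)

Section Regular.
Context {R : realType} {p : R} {p1 : 1 < p}.
Implicit Types (c : nat -> nat -> R[i]).

(** Coefficients of [w] along the rays 1, -1, i, -i. For j >= 4 the default of the list makes the
    value 0, so bounds hold for every [j]. *)
Definition ray_part (w : R[i]) (j : nat) : R :=
  Num.max [:: complex.Re w; - complex.Re w; complex.Im w; - complex.Im w]`_j 0.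

Lemma ray_part_le w j : ray_part w j <= normc w.
Proof.
have [reP imP] := normc_ge_Re_Im w; have w0 := normc_ge0 w.
rewrite ge_max w0 andbT; move: reP imP; rewrite !ler_norml.
by case: j => [|[|[|[|j]]]] /= /andP[? ?] /andP[? ?] //;
  rewrite ?nth_nil //; lra.
Qed.

Lemma ray_part_sum w :
  w = \sum_(j < 4) [:: 1; -1; 'i; - 'i]`_j * (ray_part w j)%:C.
Proof.
rewrite !big_ord_recl big_ord0 /= /ray_part /=.
have maxN (r : R) : Num.max r 0 - Num.max (- r) 0 = r.
  by rewrite /Num.max; do 2!case: ifP => //; lra.
case: w => a b /=; rewrite -[in LHS](maxN a) -[in LHS](maxN b).
by simpc; congr (_ +i* _); ring.
Qed.

Lemma triangular_ge0 c (x : nat -> R[i]) n :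
  (forall n m, 0 <= c n m) -> (forall m, 0 <= x m) -> 0 <= triangular c x n.
Proof. by move=> c0 x0; apply: sumr_ge0 => m _; rewrite mulr_ge0. Qed.

Lemma regular_triangular (a : R) (b d : R[i]) c (T : ces p1 -> ces p1) :
  a < 1 - p^-1 -> (forall n m, normc (c n m) <= resolvent_kernel a n m) ->
  continuous_operators (ces p1) T ->
  (forall (x : ces p1) n, T x n = b * x n + d * triangular c x n) ->
  regular_operators T.
Proof.
move=> aq cb contT TE; split=> //.
pose C j n m : R[i] := (ray_part (c n m) j)%:C.
have Cb j n m : normc (C j n m) <= resolvent_kernel a n m.
  have j0 : 0 <= ray_part (c n m) j by rewrite le_max lexx orbT.
  apply: le_trans (cb n m); apply: le_trans (ray_part_le (c n m) j).
  by rewrite /= expr0n /= addr0 sqrtr_sqr ger0_norm.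
pose S j (x : ces p1) := Ces p1 (triangular_in_ces _ _ x
  (ces_norm_triangular (p1 := p1) _ a x aq (Cb j))).
pose e : seq R[i] := [:: 1; -1; 'i; - 'i].
(* Index 0 carries the identity with coefficient [b]; index j + 1 carries [S j], with [d] times the
   fourth root of unity that belongs to ray j. *)
exists 5, (fun i => if val i is j.+1 then d * e`_j else b),
  (fun i => if val i is j.+1 then S j else id); split=> [[[|j] _] /=|x].
- split; last by [].
  by split; [move=> ? ? ? | move=> ?; exact: cvg_id].
- split; first apply: (@ces_bounded_continuous _ _ _ _ (1 - p^-1 - a)^-1).
  + exact: (@triangular_linear _ _ _ (C j)).
  + by move=> x; exact: (ces_norm_triangular (p1 := p1)).
  move=> x /cesleP x0; apply/cesleP => n.
  apply: triangular_ge0 => // k m.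
  by rewrite lecR le_max lexx orbT.
- apply: ces_ext => n.
  have evD (y z : ces p1) : (y + z) n = y n + z n by [].
  have evZ (l : R[i]) (y : ces p1) : (l *: y) n = l * y n by [].
  have ev0 : (0 : ces p1) n = 0 by [].
  rewrite TE big_ord_recl evD evZ; congr (_ + _).
  rewrite (big_morph (fun y : ces p1 => ces_seq y n) evD ev0).
  transitivity (\sum_(j < 4) d * (e`_j * triangular (C j) x n)); last first.
    by apply: eq_bigr => j _; rewrite evZ /= mulrA.
  rewrite -mulr_sumr; congr (_ * _).
  under [RHS]eq_bigr do rewrite /triangular mulr_sumr.
  rewrite exchange_big; apply: eq_bigr => m _ /=.
  rewrite [in LHS](ray_part_sum (c n m)) mulr_suml.
  by apply: eq_bigr => j _; rewrite mulrA.
Qed.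

(** For z = 0 the equation y = C (x + z y) reads y = C x. Hence C is V_0, and the resolvent estimate
    also bounds C. *)
Lemma cesaro_meanE_triangular (x : nat -> R[i]) n :
  cesaro_mean x n = triangular (resolvent_kernel 0) x n.
Proof.
have [yE _] := triangular_resolventE 0 x (cesaro_mean x)
  (fun k => ltac:(by rewrite eq_sym pnatr_eq0)).
apply: yE => k; congr (cesaro_mean _ k); apply/funext => i.
by rewrite mul0r addr0.
Qed.

Lemma cesaro_continuous : continuous_operators (ces p1) (cesaro_operator p1).
Proof.
(* At a = 0 the constant is Hardy's p / (p - 1). *)
apply: (@ces_bounded_continuous _ _ _ _ (1 - p^-1 - 0)^-1) => [|x].
  by apply: triangular_linear => x n; exact: cesaro_meanE_triangular.
rewrite [ces_seq _](funext (cesaro_meanE_triangular x)).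
apply: (ces_norm_triangular (p1 := p1)) => [|n m].
  by rewrite subr_gt0 invf_lt1 // (lt_trans _ p1).
exact: normc_resolvent_kernel.
Qed.

Lemma cesaro_positive : positive_operator (cesaro_operator p1).
Proof.
by move=> x /cesleP x0; apply/cesleP => n; apply: cesaro_mean_ge0.
Qed.

End Regular.

(** * Slow decay of the homogeneous recursion for Re z >= 1 - 1/p *)

Section Exclusion.
Context {R : realType} {p : R} {p1 : 1 < p}.

Let p_gt0 : 0 < p. Proof. exact: lt_trans p1. Qed.

(** Past [k0] each term is at least c / (k + 1), so bounded partial sums would bound those of the
    harmonic series. *)
Lemma sum_powR_unbounded (w : nat -> R) (b c B : R) (k0 : nat) : 0 < c ->
  (forall k, (k0 <= k)%N -> c <= k.+1%:R * w k `^ b) ->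
  ~ (forall n, \sum_(k < n) w k `^ b <= B).
Proof.
move=> c0 cw Bw; apply: (@dvg_harmonic R); apply: nondecreasing_is_cvgn.
  apply/nondecreasing_series => // n _ _; exact: harmonic_ge0.
exists (\sum_(k < k0) harmonic k + c^-1 * B) => _ [n _ <-].
have le_h m : series (@harmonic R) m <=
    \sum_(k < k0) harmonic k + c^-1 * \sum_(k < m) w k `^ b.
  rewrite /series /= big_mkord; elim: m => [|m IH].
    by rewrite !big_ord0 mulr0 addr0 sumr_ge0 // => k _; exact: harmonic_ge0.
  have [mk|km] := ltnP m k0.
    apply: (@le_trans _ _ (\sum_(k < k0) harmonic k)).
      rewrite -!(big_mkord xpredT harmonic)
        [leRHS](big_cat_nat _ (n := m.+1)) //=.
      by rewrite lerDl sumr_ge0 // => k _; exact: harmonic_ge0.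
    rewrite lerDl mulr_ge0 ?invr_ge0 ?(ltW c0) // sumr_ge0 // => k _.
    exact: powR_ge0.
  rewrite !big_ord_recr /= mulrDr addrA lerD // /harmonic /=.
  rewrite -(ler_pM2l c0) mulVKf ?gt_eqF // ler_pdivrMr ?ltr0n //.
  by rewrite mulrC cw.
by apply: le_trans (le_h n) _; rewrite lerD2l ler_pM2l ?invr_gt0.
Qed.

Lemma powR1D_le (t b : R) : 0 <= t -> 0 <= b -> (1 + t) `^ b <= expR (t * b).
Proof.
move=> t0 b0; rewrite expRM; apply: ge0_ler_powR => //.
- by rewrite nnegrE addr_ge0.
- by rewrite nnegrE expR_ge0.
- exact: expR_ge1Dx.
Qed.

(* With beta = p (Im z)^2 / 2, [normc (k + 2 - z) <= (k + 1) (1 + t)] where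
   [p t <= 1 / (k + 1 - beta)], and [(1 + t) `^ p <= expR (p t)]. *)
Lemma resolvent_step (z : R[i]) (u v : R) (k : nat) :
  1 - p^-1 <= complex.Re z -> complex.Re z <= k.+1%:R ->
  p * complex.Im z ^+ 2 / 2 < k.+1%:R -> 0 <= u -> 0 <= v ->
  normc (k.+2%:R - z) * v = k.+1%:R * u ->
  (k%:R - p * complex.Im z ^+ 2 / 2) * u `^ p <=
  (k.+1%:R - p * complex.Im z ^+ 2 / 2) * v `^ p.
Proof.
case: z => a b /=; set s := p^-1; set beta := p * b ^+ 2 / 2.
move=> sa ak bk u0 v0 uv.
have s0 : 0 < s by rewrite invr_gt0.
set m : R := k.+1%:R; have m0 : 0 < m by rewrite ltr0n.
(* Chosen so that m (1 + t) = m + 1/p + b^2 / (2 m), whose square is at least (m + 1/p)^2 + b^2. *)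
pose t := (s + b ^+ 2 / 2 / m) / m.
have b2 : 0 <= b ^+ 2 by rewrite sqr_ge0.
have t0 : 0 <= t by rewrite divr_ge0 ?addr_ge0 ?divr_ge0 // ltW.
have rt : normc (k.+2%:R - (a +i* b)) <= m * (1 + t).
  have -> : k.+2%:R - (a +i* b) = (m + 1 - a) +i* (- b).
    by rewrite -(rmorph_nat (real_complex R)) -[k.+2%:R]natr1 -/m; simpc.
  have e0 : 0 <= m * (1 + t) by rewrite mulr_ge0 ?addr_ge0 // ltW.
  rewrite -(ger0_norm e0) -sqrtr_sqr /=; apply: ler_wsqrtr.
  have -> : m * (1 + t) = m + s + b ^+ 2 / 2 / m.
    by rewrite /t; field; rewrite gt_eqF.
  set d := b ^+ 2 / 2 / m.
  have d0 : 0 <= d by rewrite !divr_ge0 // ltW.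
  have dm : 2 * (d * m) = b ^+ 2 by rewrite /d; field; rewrite gt_eqF.
  have h1 : 0 <= m + 1 - a <= m + s by apply/andP; split; lra.
  have h2 : (m + 1 - a) ^+ 2 <= (m + s) ^+ 2.
    by case/andP: h1 => ? ?; rewrite ler_sqr ?nnegrE //; lra.
  rewrite sqrrN -dm; nra.
have ut : u <= (1 + t) * v.
  by rewrite -(ler_pM2l m0) -uv mulrA ler_wpM2r.
have upt : u `^ p <= expR (t * p) * v `^ p.
  apply: (@le_trans _ _ (((1 + t) * v) `^ p)).
    by apply: ge0_ler_powR; rewrite ?nnegrE ?(ltW p_gt0) ?mulr_ge0 ?addr_ge0.
  by rewrite powRM ?addr_ge0 // ler_wpM2r ?powR_ge0 // powR1D_le // ltW.
have mb : 0 < m - beta by rewrite subr_gt0.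
have tp : (m - beta) * (t * p) <= 1.
  have -> : t * p = (1 + beta / m) / m.
    by rewrite /t /s /beta; field; rewrite !gt_eqF.
  rewrite mulrA ler_pdivrMr // mul1r.
  have -> : (m - beta) * (1 + beta / m) = m - beta ^+ 2 / m.
    by field; rewrite gt_eqF.
  by rewrite gerBl divr_ge0 ?sqr_ge0 // ltW.
have kE : k%:R = m - 1 :> R by rewrite /m -natr1 addrK.
(* Since exp(-t p) >= 1 - t p and (m - beta) t p <= 1, the right side is at least m - beta - 1 = k -
   beta. *)
have kexp : k%:R - beta <= (m - beta) * expR (- (t * p)).
  have : (m - beta) * (1 - t * p) <= (m - beta) * expR (- (t * p)).
    by rewrite ler_wpM2l ?(ltW mb) // expR_ge1Dx.
  by apply: le_trans; rewrite kE; lra.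
have [kb|kb] := leP (k%:R - beta) 0.
  apply: (@le_trans _ _ 0); first by rewrite mulr_le0_ge0 // powR_ge0.
  by rewrite mulr_ge0 ?powR_ge0 // ltW.
apply: le_trans (ler_wpM2l (ltW kb) upt) _; rewrite mulrA.
rewrite ler_wpM2r ?powR_ge0 //.
by rewrite -ler_pdivlMr ?expR_gt0 // -expRN.
Qed.

(** By [resolvent_step], the p-th power of w k times k - beta is eventually nondecreasing, so that
    power is at least a positive constant over k + 1. *)
Lemma resolvent_not_lp (z : R[i]) (w : nat -> R) (B : R) :
  1 - p^-1 <= complex.Re z -> (forall k, 0 < w k) ->
  (forall k, normc (k.+2%:R - z) * w k.+1 = k.+1%:R * w k) ->
  ~ (forall n, \sum_(k < n) w k `^ p <= B).
Proof.
move=> zp w0 wS; set beta := p * complex.Im z ^+ 2 / 2.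
have beta0 : 0 <= beta by rewrite divr_ge0 // mulr_ge0 ?sqr_ge0 // ltW.
(* From [k0] on, k exceeds both Re z and beta: [resolvent_step] applies and the weight k - beta is
   positive. *)
set k0 := Num.bound (`|complex.Re z| + beta).
have k0P : `|complex.Re z| + beta < k0%:R.
  by apply: le_lt_trans (archi_boundP _); rewrite ?ler_norm // addr_ge0.
have kP k : (k0 <= k)%N -> complex.Re z < k%:R /\ beta < k%:R.
  rewrite -(ler_nat R) => k0k; have := lt_le_trans k0P k0k.
  by have := ler_norm (complex.Re z); have := normr_ge0 (complex.Re z); lra.
apply: (@sum_powR_unbounded w p ((k0%:R - beta) * w k0 `^ p) B k0).
  by rewrite mulr_gt0 ?powR_gt0 // subr_gt0; case: (kP k0 (leqnn _)).
have mono k : (k0 <= k)%N ->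
    (k0%:R - beta) * w k0 `^ p <= (k%:R - beta) * w k `^ p.
  elim: k => [|k IH]; first by rewrite leqn0 => /eqP ->.
  rewrite leq_eqVlt ltnS => /orP[/eqP -> //|k0k].
  apply: le_trans (IH k0k) _; have [zk bk] := kP k k0k.
  have k1 : k%:R <= k.+1%:R :> R by rewrite ler_nat.
  by apply: resolvent_step; rewrite ?(ltW (w0 _)) //;
    [lra | exact: lt_le_trans bk k1].
move=> k k0k; apply: le_trans (mono k k0k) _.
by rewrite ler_wpM2r ?powR_ge0 // -natr1; lra.
Qed.

End Exclusion.

(** * What the existence of an inverse of l - C forces on l *)

Section Spectrum.
Context {R : realType} {p : R} {p1 : 1 < p}.

Let p_gt0 : 0 < p. Proof. exact: lt_trans p1. Qed.

Lemma ces_norm_powR (y : ces p1) :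
  (\sum_(0 <= k <oo) (cesaro_mean (fun i => normc (y i)) k `^ p)%:E =
    (fine (ces_norm p y) `^ p)%:E)%E.
Proof.
rewrite -poweR_EFin ces_norm_fineK /ces_norm -poweRrM mulVf ?gt_eqF //.
by rewrite poweRe1 // nneseries_ge0 // => n _ _; rewrite lee_fin powR_ge0.
Qed.

Lemma ces_partial_sum_le (y : ces p1) n :
  \sum_(k < n) cesaro_mean (fun i => normc (y i)) k `^ p <=
  fine (ces_norm p y) `^ p.
Proof.
rewrite -lee_fin -ces_norm_powR -sumEFin -(big_mkord xpredT
  (fun k => (cesaro_mean (fun i => normc (y i)) k `^ p)%:E)).
by apply: nneseries_lim_ge => k _ _; rewrite lee_fin powR_ge0.
Qed.

Lemma normc_cesaro_mean (x : nat -> R[i]) n :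
  normc (cesaro_mean x n) <= cesaro_mean (fun k => normc (x k)) n.
Proof.
rewrite normcM normcV (normcMn 1) normc1.
by rewrite ler_wpM2l ?invr_ge0 // normc_sum.
Qed.

Lemma normc_cesaro_mean_le (y : ces p1) n :
  normc (cesaro_mean y n) <= fine (ces_norm p y).
Proof.
apply: le_trans (normc_cesaro_mean _ _) _; rewrite leNgt; apply/negP => lty.
have := ces_partial_sum_le y n.+1; rewrite big_ord_recr /= leNgt => /negP.
apply; apply: (@lt_le_trans _ _ (cesaro_mean (fun k => normc (y k)) n `^ p)).
  apply: gt0_ltr_powR; rewrite ?nnegrE ?cesaro_mean_normc_ge0 //.
  by rewrite fine_ge0 // ces_norm_ge0.
by rewrite lerDr sumr_ge0 // => k _; exact: powR_ge0.
Qed.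

Definition delta_seq (n k : nat) : R[i] := (k == n)%:R.

Lemma cesaro_mean_delta_seq n k :
  cesaro_mean (fun i => normc (delta_seq n i)) k =
  (if (n <= k)%N then k.+1%:R^-1 else 0).
Proof.
rewrite /cesaro_mean.
have -> : \sum_(i < k.+1) normc (delta_seq n i) = (n < k.+1)%:R.
  elim: k.+1 => [|m IH]; first by rewrite big_ord0.
  rewrite big_ord_recr /= IH /delta_seq (normcMn 1) normc1 -natrD; congr _%:R.
  by rewrite ltnS (leq_eqVlt n m) [n == m]eq_sym; case: ltngtP.
by rewrite ltnS; case: ifP; rewrite ?mulr1 ?mulr0.
Qed.

(** The means of a unit vector are dominated by those of the first one, which are p-summable by
    Hardy's inequality. *)
Lemma delta_seq_in_ces n : delta_seq n \in ces_pred p.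
Proof.
have le0 : (ces_norm p (delta_seq n) <= 1%:E * ces_norm p (delta_seq 0))%E.
  apply: (ces_norm_le (p1 := p1)) => // m; apply: ler_sum => k _.
  rewrite mul1r !cesaro_mean_delta_seq leq0n.
  by case: ifP => // _; rewrite powR0 ?gt_eqF // powR_ge0.
apply/asboolP; apply: le_lt_trans le0 _; rewrite mul1e.
rewrite ces_normE.
have -> : cesaro_mean (fun k => normc (delta_seq 0 k)) =
    cesaro_mean (fun k => (k == 0)%:R).
  apply/funext => k; rewrite /cesaro_mean; congr (_ * _).
  by apply: eq_bigr => i _; rewrite /delta_seq (normcMn 1) normc1.
apply: le_lt_trans (hardy p1 (fun k => ler0n _ _)) _.
rewrite lte_mul_pinfty // ?lee_fin ?powR_ge0 //.
rewrite /lp_norm (nneseriesD1 (n := 0)) //.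
rewrite [X in (_ + X)%E]eseries0; last first.
  by move=> k _ /negPf /= ->; rewrite normr0 powR0 ?gt_eqF.
by rewrite adde0 poweR_EFin ltry.
Qed.

Definition delta_ces n : ces p1 := Ces p1 (delta_seq_in_ces n).

(** The p-th power of the norm of the unit vector at n is the tail from n of the sum of (k +
    1)^(-p). *)
Lemma delta_ces_norm_small (e : R) : 0 < e ->
  exists n, fine (ces_norm p (delta_ces n)) < e.
Proof.
move=> e0; pose f k : \bar R := (k.+1%:R^-1 `^ p)%:E.
have f0 k : (0 <= f k)%E by rewrite lee_fin powR_ge0.
have fE n : (\sum_(n <= k <oo) f k =
    (fine (ces_norm p (delta_ces n)) `^ p)%:E)%E.
  rewrite -ces_norm_powR (nneseries_split 0 n); last first.
    by move=> k _; rewrite lee_fin powR_ge0.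
  rewrite add0n big_nat_cond big1 ?add0e; last first.
    move=> k /andP[/andP[_ kn] _]; rewrite cesaro_mean_delta_seq leqNgt kn /=.
    by rewrite powR0 ?gt_eqF.
  rewrite [LHS]eseries_cond [RHS]eseries_cond.
  by apply: eq_eseriesr => k nk; rewrite cesaro_mean_delta_seq ifT.
(* The case n = 0 of [fE]: convergence comes from the first unit vector lying in ces(p). *)
have foo : (\sum_(0 <= k <oo) f k < +oo)%E by rewrite fE ltry.
have /fine_cvgP[_ /cvgrPdist_lt /(_ (e `^ p)) ] :=
  nneseries_tail_cvg foo (fun k _ => f0 k).
rewrite powR_gt0 // => /(_ isT) [n _ /(_ n (leqnn n))].
rewrite /= fE /= sub0r normrN ger0_norm ?powR_ge0 // => lte; exists n.
rewrite ltNge; apply/negP => len; move: lte; rewrite ltNge => /negP; apply.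
apply: ge0_ler_powR; rewrite ?nnegrE ?(ltW p_gt0) ?(ltW e0) //.
by rewrite fine_ge0 // ces_norm_ge0.
Qed.

Context {l : R[i]} {S : ces p1 -> ces p1}.
Hypothesis contS : continuous_operators (ces p1) S.
Hypothesis SK : forall x, l *: S x - cesaro_operator p1 (S x) = x.

Let SE (x : ces p1) n : l * S x n - cesaro_mean (S x) n = x n.
Proof. exact: (congr1 (fun y : ces p1 => y n) (SK x)). Qed.

(* The unit vectors accumulate at 0 in [ces p1], whereas
   [cesaro_mean (S e) = - e] would force [S e] to have norm at least 1. *)
Lemma resolvent_neq0 : l != 0.
Proof.
apply/eqP => l0; have [linS /(_ 0) /cvgrPdist_lt /(_ 1 ltr01)] := contS.
have -> : S 0 = 0.
  have := linS (-1) 0 0; rewrite !scaleN1r oppr0 addr0 => e.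
  by rewrite e addNr.
move=> /nbhs_ballP [e e0 eS].
(* The radius is a complex scalar; being positive, it is real. *)
have eC : (complex.Re e)%:C = e.
  by case: (e) e0 => a b /=; rewrite ltcE /= => /andP[/eqP -> _].
have [|n en] := delta_ces_norm_small (complex.Re e).
  by move: e0; rewrite /= -eC ltcR.
have := eS (delta_ces n); rewrite -ball_normE /= !sub0r !normrN -eC.
rewrite !ces_CnormE !ltcR => /(_ en); rewrite ltNge => /negP; apply.
apply: le_trans (normc_cesaro_mean_le (S (delta_ces n)) n).
have := SE (delta_ces n) n; rewrite l0 mul0r sub0r => /(canRL opprK) ->.
by rewrite normcN /= /delta_seq eqxx normc1.
Qed.

Let mean (x : ces p1) := cesaro_mean (S x).

Let meanE (x : ces p1) n :
  mean x n = cesaro_mean (fun k => l^-1 * x k + l^-1 * mean x k) n.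
Proof.
congr (cesaro_mean _ n); apply/funext => k.
rewrite -mulrDr -(SE x k) /mean subrK.
by rewrite mulKf // resolvent_neq0.
Qed.

Let mean0 (x : ces p1) : (1 - l^-1) * mean x 0 = l^-1 * x 0%N.
Proof.
have := meanE x 0; rewrite /cesaro_mean big_ord1 invr1 mul1r => e.
by rewrite mulrBl mul1r {1}e addrK.
Qed.

Let meanS (x : ces p1) n :
  (n.+2%:R - l^-1) * mean x n.+1 = n.+1%:R * mean x n + l^-1 * x n.+1.
Proof.
have := cesaro_meanS (fun k => l^-1 * x k + l^-1 * mean x k) n.
by rewrite -!meanE => e; rewrite mulrBl e; ring.
Qed.

(** If 1/l = n + 1, take the unit vector at n. Its means vanish before n, and at n the recursion
    reads 0 = 1/l because the coefficient of the new mean vanishes. *)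
Lemma resolvent_inv_neq_nat n : l^-1 != n.+1%:R.
Proof.
apply/eqP => ln; have z0 : l^-1 != 0 by rewrite invr_neq0 ?resolvent_neq0.
have dn k : (k < n)%N -> k.+1%:R - l^-1 != 0.
  by move=> kn; rewrite ln subr_eq0 eqr_nat eqSS ltn_eqF.
have Y0 k : (k < n)%N -> mean (delta_ces n) k = 0.
  elim: k => [n0|k IH kn]; apply/eqP.
    have := mean0 (delta_ces n); rewrite /= /delta_seq ltn_eqF // mulr0 => /eqP.
    by rewrite mulf_eq0 (negPf (dn 0%N n0)).
  have := meanS (delta_ces n) k.
  rewrite IH ?(ltnW kn) // mulr0 add0r /= /delta_seq ltn_eqF // mulr0 => /eqP.
  by rewrite mulf_eq0 (negPf (dn _ kn)).
case: n ln Y0 {dn} => [|n] ln Y0.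
  have := mean0 (delta_ces 0); rewrite ln subrr mul0r mulr1 => /eqP.
  by rewrite eq_sym oner_eq0.
have := meanS (delta_ces n.+1) n; rewrite -ln subrr mul0r Y0 // mulr0 add0r.
by rewrite /= /delta_seq eqxx mulr1 => /esym /eqP; rewrite (negPf z0).
Qed.

(** Past index 0 the means of S applied to the first unit vector solve the homogeneous recursion.
    They are p-summable because S takes values in ces(p), whereas [resolvent_not_lp] forbids this
    for Re (1/l) >= 1 - 1/p. *)
Lemma resolvent_inv_Re_lt : complex.Re l^-1 < 1 - p^-1.
Proof.
rewrite ltNge; apply/negP => lp; set x := delta_ces 0.
have YS k : (k.+2%:R - l^-1) * mean x k.+1 = k.+1%:R * mean x k.
  by rewrite meanS /= /delta_seq mulr0 addr0.
(* A zero would propagate backwards to index 0, where the mean satisfies (1 - 1/l) Y_0 = 1/l. *)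
have Y0 k : mean x k != 0.
  elim: k => [|k IH]; apply: contraTneq isT => Y.
    have := mean0 x; rewrite Y mulr0 /= /delta_seq eqxx mulr1 => /esym /eqP.
    by rewrite invr_eq0 (negPf resolvent_neq0).
  have := YS k; rewrite Y mulr0 => /esym /eqP.
  by rewrite mulf_eq0 pnatr_eq0 (negPf IH).
apply: (@resolvent_not_lp _ _ p1 l^-1 (fun k => normc (mean x k))
  (fine (ces_norm p (S x)) `^ p)) => // [k|k|n].
- rewrite lt_neqAle normc_ge0 andbT eq_sym.
  by apply: contraNneq (Y0 k) => /eq0_normc ->.
- by rewrite -normcM YS normcM (normcMn 1) normc1.
- apply: le_trans (ces_partial_sum_le _ n); apply: ler_sum => k _.
  apply: ge0_ler_powR; rewrite ?nnegrE ?(ltW p_gt0) ?normc_ge0 //.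
    exact: cesaro_mean_normc_ge0.
  exact: normc_cesaro_mean.
Qed.

Lemma resolvent_regular : regular_operators S.
Proof.
have lt1 := resolvent_inv_Re_lt.
apply: (@regular_triangular _ _ _ (complex.Re l^-1) l^-1 (l^-1 * l^-1)
  (resolvent_kernel l^-1)) => // [n m|x n].
  apply: normc_resolvent_kernel => //.
  by rewrite (lt_le_trans lt1) // gerBl invr_ge0 ltW.
(* The source in [meanE] is x / l, which accounts for the second factor 1/l in front of the
   matrix. *)
have /triangular_resolventE YE := meanE x.
have -> : S x n = l^-1 * (x n + mean x n).
  by rewrite -(SE x n) /mean subrK mulKf // resolvent_neq0.
rewrite mulrDr YE; last by move=> k; exact: resolvent_inv_neq_nat.
rewrite -mulrA; congr (_ + _ * _); rewrite /triangular mulr_sumr.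
by apply: eq_bigr => m _; rewrite mulrCA.
Qed.

End Spectrum.

Theorem proposition5p1 (R : realType) (p : R) (p1 : 1 < p) :
  [/\ continuous_operators (ces p1) (cesaro_operator p1),
      positive_operator (cesaro_operator p1) &
      order_spectrum (cesaro_operator p1) = spectrum (cesaro_operator p1)].
Proof.
split; [exact: cesaro_continuous | exact: cesaro_positive |].
(* By contraposition each inclusion transfers an inverse: a continuous one is regular by
   [resolvent_regular], and a regular one is continuous by definition. *)
apply/seteqP; split=> l; apply: contra_not => -[S [contS KS SK]]; exists S.
  by split=> //; exact: resolvent_regular contS SK.
by split=> //; case: contS.
Qed.
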